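(* Let $n,d\ge 1$ and let $f_1,\dots,f_n:\mathbb{R}^d\to\mathbb{R}$ be convex and differentiable with bounded gradients, and suppose that $X^*=\operatorname{argmin}_{x\in\mathbb{R}^d}F(x)$ is nonempty, where $F(x)=\sum_{i=1}^n f_i(x)$. Let $\alpha:[0,\infty)\to(0,1]$ be a non-increasing function with $\int_0^\infty\alpha(t)\,dt=\infty$ and $\int_0^\infty\alpha^2(t)\,dt<\infty$. Let $\{\mathcal{G}(t)\}_{t\ge 0}$ be a sequence of directed graphs on $[n]$, and consider a dynamics $$\dot{x}_i(t)=p_i(t,\mathbf{x}(t),\mathbf{w}(t),u_i(t)),\quad \dot{w}_i(t)=q_i(t,\mathbf{x}(t),\mathbf{w}(t)),\quad y_i(t)=h_i(t,x_i(t),w_i(t),u_i(t)),\qquad i\in[n],$$ that is a distributed flow tracker with respect to a set $Q\subseteq\mathbb{R}^{n\times d}\times\mathbb{R}^N$ for $\{\mathcal{G}(t)\}_{t\ge0}$. Then, for any initial condition $(\mathbf{x}(0),\mathbf{w}(0))\in Q$, the feedback law $u_i(t)=-\alpha(t)\nabla f_i(y_i(t))$, $i\in[n]$, solves the problem of minimizing $F$ over $\mathbb{R}^d$, i.e., for any solution of the dynamics (with this feedback law) starting at $(\mathbf{x}(0),\mathbf{w}(0))\in Q$, there exists $x^*\in X^*$ such that $\lim_{t\to\infty}y_i(t)=x^*$ for all $i\in[n]$.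
   Context: Notation: $[n]=\{1,\dots,n\}$. Vectors in $\mathbb{R}^d=\mathbb{R}^{1\times d}$ (including gradients) are row vectors; $\mathbf{x}\in\mathbb{R}^{n\times d}$ has rows $x_1,\dots,x_n$, and $\bar{x}=\frac1n\sum_{i=1}^n x_i$. $\|\cdot\|$ is the $\ell_2$-norm on vectors and the induced operator norm on matrices. $\mathbf{u}(t)\in\mathbb{R}^{n\times d}$ has rows $u_1(t),\dots,u_n(t)$. Dynamics: for each $i\in[n]$ and $t\ge 0$, $x_i(t)\in\mathbb{R}^{d}$, $w_i(t)\in\mathbb{R}^{n_i}$ with $n_i\ge 0$, $y_i(t)\in\mathbb{R}^d$, $u_i(t)\in\mathbb{R}^d$ (control input); $N=\sum_{i=1}^n n_i$ and $\mathbf{w}(t)\in\mathbb{R}^N$ collects the $w_i(t)$. The maps are $p_i:\mathbb{R}\times\mathbb{R}^{n\times d}\times\mathbb{R}^N\times\mathbb{R}^d\to\mathbb{R}^d$, $q_i:\mathbb{R}\times\mathbb{R}^{n\times d}\times\mathbb{R}^N\to\mathbb{R}^{n_i}$, $h_i:\mathbb{R}\times\mathbb{R}^d\times\mathbb{R}^{n_i}\times\mathbb{R}^d\to\mathbb{R}^d$, where $p_i,q_i$ have sufficient continuity properties such that a continuous solution to the system exists. Graphs: $\mathcal{G}(t)=([n],\mathcal{E}(t))$ with $\mathcal{E}(t)\subseteq[n]\times[n]$. Distributed flow tracker: the dynamics is a distributed flow tracker with respect to $Q\subseteq\mathbb{R}^{n\times d}\times\mathbb{R}^N$ for $\{\mathcal{G}(t)\}_{t\ge0}$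 if: (I) (Distributed) $\frac{\partial p_i}{\partial x_j}=0$, $\frac{\partial p_i}{\partial w_j}=0$, $\frac{\partial q_i}{\partial x_j}=0$ and $\frac{\partial q_i}{\partial w_j}=0$ for all $(i,j)\notin\mathcal{E}(t)$ and all $t\ge0$; (II) (Average-input tracker) for some constant $c_1>0$, $\dot{\bar{x}}(t)=c_1\sum_{i=1}^n u_i(t)$; (III) (Average-state observer) for all $i\in[n]$, the bound $$\|y_i(t)-\bar{x}(t)\|\le c_2\left(\lambda^t\|\mathbf{x}(0)\|+\int_0^t\lambda^{t-s}\|\mathbf{u}(s)\|\,ds\right)$$ holds for all initial conditions $(\mathbf{x}(0),\mathbf{w}(0))\in Q$ and all smooth control inputs $\mathbf{u}:\mathbb{R}^+\to\mathbb{R}^{n\times d}$, for some $\lambda\in[0,1)$ and $c_2>0$ (possibly dependent on $\mathbf{u}$).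
   Formalization: Since the feedback input need not be smooth and the claim fails otherwise, tracker conditions (II) and (III) are assumed for a class of inputs that contains all smooth inputs and the feedback input u_i(t) = -α(t)∇f_i(y_i(t)) of the solution considered, not for smooth inputs only. *)

(* Defs.v *)
From HB Require Import structures.
From mathcomp Require Import all_boot all_order all_algebra.
From mathcomp Require Import all_classical all_reals all_analysis.

Set Implicit Arguments.
Unset Strict Implicit.
Unset Printing Implicit Defensive.

Import Order.TTheory GRing.Theory Num.Theory.
Import numFieldNormedType.Exports.

Local Open Scope classical_set_scope.
Local Open Scope ring_scope.

(* The library norm `|x| on matrices is the sup norm, so the l2 norm (used below
   on row and column vectors only) and the operator norm it induces are
   introduced here. *)
Definition l2norm (R : realType) (m k : nat) (v : 'M[R]_(m, k)) : R :=
  Num.sqrt (\sum_(i < m) \sum_(j < k) v i j ^+ 2).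

Definition opnorm (R : realType) (m k : nat) (A : 'M[R]_(m, k)) : R :=
  sup [set l2norm (A *m v) | v in [set v : 'cV[R]_k | l2norm v <= 1]].

Definition gradient (R : realType) (d : nat) (g : 'rV[R]_d -> R)
    (z : 'rV[R]_d) : 'rV[R]_d :=
  \row_(k < d) 'D_(delta_mx 0 k) g z.

Definition argmin (R : realType) (T : Type) (F : T -> R) : set T :=
  [set z | forall z', F z <= F z'].

Definition average (R : realType) (n d : nat) (x : 'M[R]_(n, d)) : 'rV[R]_d :=
  n%:R^-1 *: \sum_(i < n) row i x.

(* Agent i has internal state w_i in R^(nw i); the vector w collecting all of
   them lives in R^N with N = \sum_i nw i, and w_i = submxrow w i. *)
Record dynamics (R : realType) (n d : nat) (nw : 'I_n -> nat) := Dynamics {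
  dyn_p : 'I_n -> R -> 'M[R]_(n, d) -> 'rV[R]_(\sum_(i < n) nw i) ->
      'rV[R]_d -> 'rV[R]_d ;
  dyn_q : forall i : 'I_n, R -> 'M[R]_(n, d) -> 'rV[R]_(\sum_(i < n) nw i) ->
      'rV[R]_(nw i) ;
  dyn_h : forall i : 'I_n, R -> 'rV[R]_d -> 'rV[R]_(nw i) ->
      'rV[R]_d -> 'rV[R]_d
}.
Arguments dyn_p {R n d nw} S i t x w v : rename.
Arguments dyn_q {R n d nw} S i t x w : rename.
Arguments dyn_h {R n d nw} S i t xi wi v : rename.

(* z' = g on [0, +oo[ in the sense of Caratheodory: z is the indefinite integral
   of the locally integrable function g.  Classical C^1 solutions are
   of this kind; the classical notion alone would be too narrow because the
   stepsize, hence the feedback input, may have jumps. *)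
Definition caratheodory (R : realType) (m : nat) (z g : R -> 'rV[R]_m) : Prop :=
  forall (k : 'I_m) (t : R), 0 <= t ->
    (@lebesgue_measure R).-integrable `[0, t] (EFin \o (fun s => g s 0 k)) /\
    z t 0 k = z 0 0 k + \int[@lebesgue_measure R]_(s in `[0, t]) g s 0 k.

Definition solution (R : realType) (n d : nat) (nw : 'I_n -> nat)
    (S : dynamics R d nw) (u x : R -> 'M[R]_(n, d))
    (w : R -> 'rV[R]_(\sum_(i < n) nw i)) : Prop :=
  forall i : 'I_n,
    caratheodory (fun t => row i (x t))
                 (fun t => dyn_p S i t (x t) (w t) (row i (u t))) /\
    caratheodory (fun t => submxrow (w t) i)
                 (fun t => dyn_q S i t (x t) (w t)).

Definition output (R : realType) (n d : nat) (nw : 'I_n -> nat)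
    (S : dynamics R d nw) (u x : R -> 'M[R]_(n, d))
    (w : R -> 'rV[R]_(\sum_(i < n) nw i)) (i : 'I_n) (t : R) : 'rV[R]_d :=
  dyn_h S i t (row i (x t)) (submxrow (w t) i) (row i (u t)).

(* Smoothness on the closed half-line [0, +oo[: u extends to a C^oo map on R. *)
Definition smooth_input (R : realType) (n d : nat) :
    set (R -> 'M[R]_(n, d)) :=
  [set u | exists v : R -> 'M[R]_(n, d),
     (forall (m : nat) (t : R), derivable (derive1n m v) t 1) /\
     (forall t : R, 0 <= t -> u t = v t)].

Definition continuous_solutions_exist (R : realType) (n d : nat)
    (nw : 'I_n -> nat) (S : dynamics R d nw)
    (Q : set ('M[R]_(n, d) * 'rV[R]_(\sum_(i < n) nw i))) : Prop :=
  forall (u : R -> 'M[R]_(n, d)) x0 w0, smooth_input u -> Q (x0, w0) ->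
    exists x w, [/\ solution S u x w, x 0 = x0 & w 0 = w0].

(* delta_mx j k is the direction of the k-th coordinate of x_j, and
   delta_mx 0 (tagnat.Rank j k) that of the k-th coordinate of w_j inside w. *)
Definition distributed (R : realType) (n d : nat) (nw : 'I_n -> nat)
    (S : dynamics R d nw) (E : R -> rel 'I_n) : Prop :=
  forall (t : R) (i j : 'I_n), 0 <= t -> ~~ E t i j ->
  forall (x : 'M[R]_(n, d)) (w : 'rV[R]_(\sum_(i < n) nw i)),
    (forall (k : 'I_d) (v : 'rV[R]_d),
       is_derive x (delta_mx j k) (fun x' => dyn_p S i t x' w v) 0) /\
    (forall (k : 'I_(nw j)) (v : 'rV[R]_d),
       is_derive w (delta_mx 0 (tagnat.Rank j k))
         (fun w' => dyn_p S i t x w' v) 0) /\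
    (forall k : 'I_d,
       is_derive x (delta_mx j k) (fun x' => dyn_q S i t x' w) 0) /\
    (forall k : 'I_(nw j),
       is_derive w (delta_mx 0 (tagnat.Rank j k))
         (fun w' => dyn_q S i t x w') 0).

(* U is the class of admissible control inputs; U = @smooth_input R n d gives the
   definition for smooth inputs.  The class is left open because a feedback
   input - alpha(t) grad f_i(y_i(t)) is in general not smooth: alpha is only
   monotone and f_i only differentiable.  A class that contains every such input
   (setT, say) makes the bounds available on every closed-loop trajectory. *)
Definition average_input_tracker (R : realType) (n d : nat) (nw : 'I_n -> nat)
    (S : dynamics R d nw)
    (Q : set ('M[R]_(n, d) * 'rV[R]_(\sum_(i < n) nw i)))
    (U : set (R -> 'M[R]_(n, d))) : Prop :=
  exists2 c1 : R, 0 < c1 &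
    forall u x w, U u -> Q (x 0, w 0) -> solution S u x w ->
    {ae @lebesgue_measure R, forall t : R, 0 < t ->
       is_derive t 1 (fun s => average (x s)) (c1 *: \sum_(i < n) row i (u t))}.

(* powR has 0 `^ 0 = 1 and 0 `^ t = 0 for t > 0, as needed when lambda = 0.
   The bound is stated in \bar R so that a non-integrable input yields +oo. *)
Definition average_state_observer (R : realType) (n d : nat) (nw : 'I_n -> nat)
    (S : dynamics R d nw)
    (Q : set ('M[R]_(n, d) * 'rV[R]_(\sum_(i < n) nw i)))
    (U : set (R -> 'M[R]_(n, d))) : Prop :=
  forall u, U u -> exists lambda c2 : R, [/\ 0 <= lambda < 1, 0 < c2 &
    forall x w, Q (x 0, w 0) -> solution S u x w ->
    forall (i : 'I_n) (t : R), 0 <= t ->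
      ((l2norm (output S u x w i t - average (x t)))%:E <=
       c2%:E * ((lambda `^ t * opnorm (x 0))%:E +
         \int[@lebesgue_measure R]_(s in `[0%R, t])
            (lambda `^ (t - s) * opnorm (u s))%:E))%E].

Definition distributed_flow_tracker (R : realType) (n d : nat)
    (nw : 'I_n -> nat) (S : dynamics R d nw)
    (Q : set ('M[R]_(n, d) * 'rV[R]_(\sum_(i < n) nw i)))
    (E : R -> rel 'I_n) (U : set (R -> 'M[R]_(n, d))) : Prop :=
  [/\ distributed S E, average_input_tracker S Q U
    & average_state_observer S Q U].

(* Main.v *)
Require Import Defs.
From HB Require Import structures.
From mathcomp Require Import all_boot all_order all_algebra.
From mathcomp Require Import all_classical all_reals all_analysis.
From mathcomp Require Import measurable_realfun ring lra.

Set Implicit Arguments.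
Unset Strict Implicit.
Unset Printing Implicit Defensive.

Import Order.TTheory GRing.Theory Num.Theory.
Import numFieldNormedType.Exports.

Local Open Scope classical_set_scope.
Local Open Scope ring_scope.

(** The inputs move the average X(t) of the states only through their sum, so
    the feedback law makes X an inexact gradient flow of F,
      X' = - c1 alpha(t) \sum_i grad f_i(y_i(t)),
    the gradients being taken at the observations y_i instead of at X.  For a
    minimiser z, convexity and the bound L on the gradients give, up to
    constants,
      d/dt |X - z|^2 <= - alpha (F(X) - F(z)) + alpha \sum_i |y_i - X|.

    With lambda <= exp(-k), the observer bounds |y_i - X| by exp(-kt) plus the
    leaky integral I of alpha, which solves I' = alpha - k I.  As alpha is
    nonincreasing, alpha I is at most the leaky integral J of alpha^2, and
    J' = alpha^2 - k J.  Hence the error term is absorbed by the function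
      W = |X - z|^2 + const (exp(-kt) + J - \int_0^t alpha^2),
    which satisfies W' <= - alpha (F(X) - F(z)) and is bounded below because
    alpha^2 is integrable.  Two facts follow.  First, W is nonincreasing, so
    |X - z| grows by less than any given amount after a suitable time
    ([flow_fejer]).  Second, F(X) comes arbitrarily close to its minimum
    arbitrarily late, since otherwise W would tend to -oo with
    - \int_0^t alpha ([flow_minimizing]).  A bounded trajectory with these two
    properties has a minimiser among its cluster points and converges to it
    ([quasi_fejer_cvg]); the y_i follow, because I tends to 0.

    Two points shape the formal argument.

    The observations y_i, and with them the input u, depend on time through the
    arbitrary maps h_i and may fail to be measurable.  Integrals are therefore
    taken only of the velocity of X, which the notion of solution makes
    integrable and which Lebesgue differentiation identifies almost everywhere
    with c1 \sum_i u_i; the integral in the observer bound is compared with the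
    integral of a measurable majorant ([le_lower_integral]).

    No function such as |X - z|^2 is differentiated.  Increments over [s, t] are
    estimated up to a multiple of (t - s)^2, which suffices for monotonicity
    ([le_of_sqr_increment]); this replaces the product rule and the fundamental
    theorem of calculus for absolutely continuous functions, as well as
    Fubini's theorem for the double integral of alpha(t) I(t). *)

(** * Monotonicity from second-order increments *)

(** Over N equal steps the allowed growth C (t - s)^2 is divided by N. *)
Lemma le_of_sqr_increment (R : realType) (W : R -> R) (a C : R) :
  (forall s t : R, a <= s -> s <= t -> W t - W s <= C * (t - s) ^+ 2) ->
  forall s t : R, a <= s -> s <= t -> W t <= W s.
Proof.
move=> WC s t as_ st; rewrite leNgt; apply/negP => Wst.
have d0 : 0 < W t - W s by rewrite subr_gt0.
have subdiv N : W t - W s <= C * (t - s) ^+ 2 / N.+1%:R.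
  pose h := (t - s) / N.+1%:R.
  have h0 : 0 <= h by rewrite divr_ge0// subr_ge0.
  have step m : W (s + m%:R * h) - W s <= m%:R * (C * h ^+ 2).
    elim: m => [|m IH]; first by rewrite !mul0r addr0 subrr.
    have amh : a <= s + m%:R * h by rewrite (le_trans as_)// lerDl mulr_ge0.
    have -> : s + m.+1%:R * h = s + m%:R * h + h by rewrite -natr1; ring.
    have := WC (s + m%:R * h) (s + m%:R * h + h) amh.
    have -> : s + m%:R * h + h - (s + m%:R * h) = h by rewrite [_ + h]addrC addrK.
    rewrite lerDl => /(_ h0) Wh.
    by rewrite -natr1 mulrDl mul1r -(subrKA (W (s + m%:R * h))) addrC lerD.
  have N0 : N.+1%:R != 0 :> R by rewrite pnatr_eq0.
  have hN : N.+1%:R * h = t - s by rewrite mulrC divfK.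
  have := step N.+1; rewrite hN subrKC => /le_trans; apply.
  by rewrite -hN le_eqVlt; apply/orP; left; apply/eqP; field.
pose N := Num.bound (`|C * (t - s) ^+ 2| / (W t - W s)).
have := archi_boundP (divr_ge0 (normr_ge0 (C * (t - s) ^+ 2)) (ltW d0)).
rewrite -/N ltr_pdivrMr// => CN.
have := subdiv N; rewrite ler_pdivlMr ?ltr0n//.
apply/negP; rewrite -ltNge (le_lt_trans (ler_norm _))// (lt_le_trans CN)//.
by rewrite mulrC ler_pM2l// ler_nat.
Qed.

Lemma expRN_le_quadratic (R : realType) (x : R) :
  0 <= x -> expR (- x) <= 1 - x + x ^+ 2.
Proof.
move=> x0; rewrite expRN.
have x1 : 0 < 1 + x by rewrite ltr_wpDr.
apply: (@le_trans _ _ (1 + x)^-1).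
  by rewrite lef_pV2 ?posrE ?expR_gt0 ?expR_ge1Dx.
rewrite -div1r ler_pdivrMr//.
have : 0 <= x ^+ 3 by rewrite exprn_ge0.
rewrite !expr2 exprSr expr2; lra.
Qed.

(** * Euclidean geometry of row vectors *)

Definition dot (R : realType) (d : nat) (u v : 'rV[R]_d) : R :=
  \sum_(k < d) u 0 k * v 0 k.

Section dot.
Variables (R : realType) (d : nat).
Implicit Types u v w z : 'rV[R]_d.

Lemma dotC u v : dot u v = dot v u.
Proof. by apply: eq_bigr => k _; rewrite mulrC. Qed.

Lemma dotDl u v w : dot (u + v) w = dot u w + dot v w.
Proof. by rewrite -big_split; apply: eq_bigr => k _; rewrite mxE mulrDl. Qed.

Lemma dotZl a u v : dot (a *: u) v = a * dot u v.
Proof. by rewrite mulr_sumr; apply: eq_bigr => k _; rewrite mxE mulrA. Qed.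

Lemma dotNl u v : dot (- u) v = - dot u v.
Proof. by rewrite -scaleN1r dotZl mulN1r. Qed.

Lemma dotDr u v w : dot w (u + v) = dot w u + dot w v.
Proof. by rewrite dotC dotDl !(dotC w). Qed.

Lemma dotZr a u v : dot v (a *: u) = a * dot v u.
Proof. by rewrite dotC dotZl (dotC v). Qed.

Lemma dotNr u v : dot v (- u) = - dot v u.
Proof. by rewrite dotC dotNl (dotC v). Qed.

Lemma dot_ge0 u : 0 <= dot u u.
Proof. by apply: sumr_ge0 => k _; rewrite -expr2 sqr_ge0. Qed.

Lemma l2normE u : l2norm u = Num.sqrt (dot u u).
Proof.
by rewrite /l2norm big_ord1; congr Num.sqrt; apply: eq_bigr => k _; rewrite expr2.
Qed.

Lemma l2norm_sqr u : l2norm u ^+ 2 = dot u u.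
Proof. by rewrite l2normE sqr_sqrtr// dot_ge0. Qed.

Lemma l2norm_ge0 (m k : nat) (A : 'M[R]_(m, k)) : 0 <= l2norm A.
Proof. exact: sqrtr_ge0. Qed.

Lemma l2norm0 (m k : nat) : l2norm (0 : 'M[R]_(m, k)) = 0.
Proof.
rewrite /l2norm big1 ?sqrtr0// => i _.
by rewrite big1// => j _; rewrite mxE expr0n.
Qed.

Lemma normr_coord_le_l2norm u k : `|u 0 k| <= l2norm u.
Proof.
rewrite l2normE -sqrtr_sqr ler_wsqrtr// /dot (bigD1 k)//= -expr2 lerDl.
by apply: sumr_ge0 => j _; rewrite -expr2 sqr_ge0.
Qed.

Lemma dot_le_coord u (e : R) :
  0 <= e -> (forall k, `|u 0 k| <= e) -> dot u u <= d%:R * e ^+ 2.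
Proof.
move=> e0 ue; rewrite mulr_natl -[in leRHS](card_ord d) -sumr_const.
apply: ler_sum => k _; rewrite -expr2 -real_normK ?num_real//.
by rewrite ler_pXn2r ?nnegrE.
Qed.

Lemma cauchy_schwarz u v : `|dot u v| <= l2norm u * l2norm v.
Proof.
rewrite !l2normE -sqrtrM ?dot_ge0// -sqrtr_sqr ler_wsqrtr//.
have [v0|v0] := eqVneq (dot v v) 0.
  suff -> : dot u v = 0 by rewrite expr0n mulr_ge0 ?dot_ge0.
  apply: big1 => k _; suff /eqP-> : v 0 k == 0 by rewrite mulr0.
  rewrite -normr_le0 -(sqrtr0 R) -v0 -l2normE.
  exact: normr_coord_le_l2norm.
(* |v|^2 times the squared distance from u to the line spanned by v, cleared
   of denominators *)
have vp : 0 < dot v v by rewrite lt_neqAle eq_sym v0 dot_ge0.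
have := dot_ge0 (dot v v *: u - dot u v *: v).
rewrite !(dotDl, dotDr, dotNl, dotNr, dotZl, dotZr) (dotC v u) => H.
have {}H : 0 <= dot v v * (dot u u * dot v v - dot u v ^+ 2).
  by apply: le_trans H _; rewrite le_eqVlt; apply/orP; left; apply/eqP; ring.
by move: H; rewrite pmulr_rge0// subr_ge0.
Qed.

Lemma ler_l2normD u v : l2norm (u + v) <= l2norm u + l2norm v.
Proof.
rewrite -(@ler_pXn2r _ 2)// ?nnegrE ?addr_ge0 ?l2norm_ge0//.
rewrite sqrrD !l2norm_sqr !(dotDl, dotDr) (dotC v u).
have := le_trans (ler_norm _) (cauchy_schwarz u v).
by rewrite mulr2n; lra.
Qed.

Lemma l2normN u : l2norm (- u) = l2norm u.
Proof. by rewrite !l2normE dotNl dotNr opprK. Qed.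

Lemma l2normZ a u : l2norm (a *: u) = `|a| * l2norm u.
Proof.
by rewrite !l2normE dotZl dotZr mulrA -expr2 sqrtrM ?sqr_ge0// sqrtr_sqr.
Qed.

Lemma mx_norm_le_l2norm u : `|u| <= l2norm u.
Proof.
rewrite [leLHS]/Num.Def.normr/= mx_normrE.
apply: bigmax_le => [|[i j] _]; rewrite ?l2norm_ge0//.
by rewrite (ord1 i) normr_coord_le_l2norm.
Qed.

End dot.

(** By Cauchy-Schwarz each coordinate of A v is at most the norm of a row.  The
    factor n is crude ([Num.sqrt n%:R] would do), but only a multiple of the
    row bound matters below. *)
Lemma opnorm_bounds (R : realType) (n d : nat) (A : 'M[R]_(n, d)) (e : R) :
  0 <= e -> (forall i, l2norm (row i A) <= e) -> 0 <= opnorm A <= n%:R * e.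
Proof.
move=> e0 Ae.
pose unit_ball := [set v : 'cV[R]_d | l2norm v <= 1].
have Ab : ubound [set l2norm (A *m v) | v in unit_ball] (n%:R * e).
  move=> _ [v v1 <-].
  have rowE i : (A *m v) i 0 = dot (row i A) v^T.
    by rewrite mxE; apply: eq_bigr => k _; rewrite !mxE.
  have vT : l2norm v^T = l2norm v.
    rewrite /l2norm big_ord1; congr Num.sqrt; apply: eq_bigr => k _.
    by rewrite big_ord1 mxE.
  have Avi i : `|(A *m v) i 0| <= e.
    rewrite rowE (le_trans (cauchy_schwarz _ _))// vT -[leRHS]mulr1.
    by rewrite ler_pM ?l2norm_ge0.
  apply: (@le_trans _ _ (Num.sqrt ((n%:R * e) ^+ 2))); last first.
    by rewrite sqrtr_sqr ger0_norm// mulr_ge0.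
  rewrite /l2norm ler_wsqrtr//.
  apply: (@le_trans _ _ (\sum_(i < n) e ^+ 2)).
    apply: ler_sum => i _; rewrite big_ord1 -real_normK ?num_real//.
    by rewrite ler_pXn2r ?nnegrE.
  rewrite sumr_const card_ord -[leLHS]mulr_natl exprMn ler_wpM2r ?sqr_ge0//.
  by rewrite -natrX ler_nat -mulnn; case: (n) => // m; rewrite leq_pmulr.
have A0 : [set l2norm (A *m v) | v in unit_ball] 0.
  exists 0; rewrite /unit_ball/=.
    by rewrite l2norm0 ler01.
  by rewrite mulmx0 l2norm0.
apply/andP; split.
  by apply: ub_le_sup A0; exists (n%:R * e).
by apply: ge_sup => //; exists 0.
Qed.

(** * Gradients of convex functions *)

Section gradient.
Variables (R : realType) (d : nat) (f : 'rV[R]_d -> R).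
Hypothesis f_diff : forall z, differentiable f z.

Lemma derive_dot_gradient (z v : 'rV[R]_d) : 'D_v f z = dot (gradient f z) v.
Proof.
rewrite deriveE// {1}(row_sum_delta v) linear_sum.
apply: eq_bigr => k _; rewrite linearZ /= mxE deriveE//.
by rewrite mulrC.
Qed.

Hypothesis f_convex : convex_function setT f.

(** The difference quotients of f at y in the direction z - y are at most
    f z - f y by convexity; let the step tend to 0 from the right. *)
Lemma gradient_ineq (y z : 'rV[R]_d) : f y + dot (gradient f y) (z - y) <= f z.
Proof.
rewrite -derive_dot_gradient addrC -lerBrDr.
have dfv : derivable f y (z - y) by exact: diff_derivable.
apply: (cvgr_to_le (cvg_dnbhs_at_right dfv)).
near=> h.
have h0 : 0 < h by near: h; exact: nbhs_right_gt.
have h1 : h <= 1 by near: h; exact: nbhs_right_le.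
rewrite /GRing.scale/= mulrC ler_pdivrMr//.
have := @f_convex (Itv01 (ltW h0) h1) z y.
rewrite !inE => /(_ I I); rewrite convRE/= /conv/= /unstable.onem.
rewrite -/(h *: (z - y)).
have -> : h *: z + (1 - h) *: y = h *: (z - y) + y.
  by rewrite scalerBl scale1r scalerBr addrCA addrC.
by rewrite mulrBl mul1r; lra.
Unshelve. all: by end_near. Qed.

End gradient.

(** What is lost in the gradient inequality when the gradient is taken at y while
    the values of f are compared at x and z: once L |x - y| for moving the
    linear term, once for the variation of f between y and x. *)
Lemma dot_gradient_lower_bound (R : realType) (d : nat) (f : 'rV[R]_d -> R)
    (L : R) :
  (forall z, differentiable f z) -> convex_function setT f ->
  (forall z, l2norm (gradient f z) <= L) ->
  forall x y z, f x - f z - 2 * L * l2norm (x - y) <= dot (x - z) (gradient f y).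
Proof.
move=> fd fc fL x y z.
have bnd a v : dot (gradient f a) v <= L * l2norm v.
  apply: le_trans (ler_norm _) _; apply: le_trans (cauchy_schwarz _ _) _.
  by rewrite ler_wpM2r ?l2norm_ge0.
have h1 := gradient_ineq fd fc y z.
have h2 := gradient_ineq fd fc x y.
have h3 := bnd x (x - y).
have h4 := bnd y (- (x - y)); rewrite l2normN in h4.
have e1 : dot (gradient f x) (y - x) = - dot (gradient f x) (x - y).
  by rewrite -dotNr opprB.
have e2 : dot (gradient f y) (z - y) =
    - dot (x - z) (gradient f y) - dot (gradient f y) (- (x - y)).
  rewrite [dot (x - z) _]dotC -!dotNr -dotDr opprK; congr dot.
  by rewrite opprB addrA subrK.
by rewrite e1 in h2; rewrite e2 in h1; lra.
Qed.

(** * Integrals over compact intervals *)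

Section integral_comparison.
Variable R : realType.
Notation mu := (@lebesgue_measure R).

(** Without measurability the integral of a nonnegative function is still the
    supremum of the integrals of the simple functions below it, which is
    monotone. *)
Lemma le_lower_integral (D : set R) (f1 f2 : R -> \bar R) :
  (forall x, D x -> (0 <= f1 x)%E) -> (forall x, D x -> (f1 x <= f2 x)%E) ->
  (\int[mu]_(x in D) f1 x <= \int[mu]_(x in D) f2 x)%E.
Proof.
move=> f10 f12.
have f20 x : D x -> (0 <= f2 x)%E.
  by move=> Dx; exact: le_trans (f10 _ Dx) (f12 _ Dx).
rewrite !ge0_integralE//; apply: ereal_sup_le => _ [h hf1 <-].
exists h => // x; apply: le_trans (hf1 x) _.
by rewrite !patchE; case: ifPn => // /set_mem; exact: f12.
Qed.

Lemma ae_imply (P Q : R -> Prop) : (forall x, P x -> Q x) ->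
  {ae mu, forall x, P x} -> {ae mu, forall x, Q x}.
Proof.
by move=> PQ; apply: filterS; first exact: (ae_filter_ringOfSetsType mu).
Qed.

(** Replacing f2 by the maximum of f1 and f2, almost everywhere equal to it,
    makes the inequality hold everywhere. *)
Lemma le_Rintegral_ae (D : set R) (f1 f2 : R -> R) : measurable D ->
  mu.-integrable D (EFin \o f1) -> mu.-integrable D (EFin \o f2) ->
  {ae mu, forall x, D x -> f1 x <= f2 x} ->
  \int[mu]_(x in D) f1 x <= \int[mu]_(x in D) f2 x.
Proof.
move=> mD if1 if2 f12.
pose h x := Num.max (f1 x) (f2 x).
have mh : measurable_fun D h.
  by apply: measurable_maxr; apply/measurable_EFinP;
    [exact: measurable_int if1|exact: measurable_int if2].
have hf2 : (\int[mu]_(x in D) (h x)%:E = \int[mu]_(x in D) (f2 x)%:E)%E.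
  apply: ae_eq_integral => //; first exact/measurable_EFinP.
    exact: measurable_int if2.
  by apply: ae_imply f12 => x f12 Dx; rewrite /h max_r ?f12.
have ih : mu.-integrable D (EFin \o h).
  have if12 : mu.-integrable D (fun x => `|(f1 x)%:E| + `|(f2 x)%:E|)%E.
    by apply: integrableD => //; apply: integrable_abse.
  apply: le_integrable if12 => //; first exact/measurable_EFinP.
  move=> x Dx /=; rewrite lee_fin [leRHS]ger0_norm ?addr_ge0// /h.
  by case: (leP (f1 x) (f2 x)) => _; rewrite ?lerDl ?lerDr normr_ge0.
have -> : \int[mu]_(x in D) f2 x = \int[mu]_(x in D) h x.
  by rewrite /Rintegral hf2.
by apply: le_Rintegral => // x Dx; rewrite /h le_max lexx.
Qed.

Lemma Rintegral_itv_diff (f : R -> R) (r s t : R) : r <= s -> s <= t ->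
  mu.-integrable `[r, t] (EFin \o f) ->
  \int[mu]_(x in `[r, t]) f x - \int[mu]_(x in `[r, s]) f x =
  \int[mu]_(x in `[s, t]) f x.
Proof.
move=> rs st itf; rewrite (@Rintegral_itvB _ _ (BLeft r) (BRight t) s)//.
rewrite Rintegral_itv_obnd_cbnd//.
apply: integrableS itf => //.
by apply: subset_itv; rewrite bnd_simp.
Qed.

Lemma integrable_itvS (f : R -> R) (a b c d : R) : a <= c -> d <= b ->
  mu.-integrable `[a, b] (EFin \o f) -> mu.-integrable `[c, d] (EFin \o f).
Proof.
move=> ac db; apply: integrableS => //.
by apply: subset_itv; rewrite bnd_simp.
Qed.

Lemma Rintegral_itv_cst (s t c : R) : s <= t ->
  \int[mu]_(x in `[s, t]) c = c * (t - s).
Proof.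
rewrite le_eqVlt => /predU1P[<-|st].
  by rewrite set_itv1 Rintegral_set1 subrr mulr0.
by rewrite Rintegral_cst//= lebesgue_measure_itv/= lte_fin st.
Qed.

Lemma integrable_itv_cst (s t c : R) : mu.-integrable `[s, t] (EFin \o cst c).
Proof.
apply: measurable_bounded_integrable => //=.
  by rewrite lebesgue_measure_itv/=; case: ifPn => // _; rewrite -EFinD ltry.
by exists `|c|; split=> // x cx y _; rewrite ltW.
Qed.

Lemma abs_Rintegral_itv_le (f : R -> R) (s t c : R) : s <= t ->
  mu.-integrable `[s, t] (EFin \o f) ->
  {ae mu, forall x, `[s, t]%classic x -> `|f x| <= c} ->
  `|\int[mu]_(x in `[s, t]) f x| <= c * (t - s).
Proof.
move=> st itf fc; rewrite -Rintegral_itv_cst// ler_norml; apply/andP; split.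
  rewrite Rintegral_itv_cst// -mulNr -Rintegral_itv_cst//.
  apply: le_Rintegral_ae => //; first exact: integrable_itv_cst.
  by apply: ae_imply fc => x fc /fc; rewrite ler_norml => /andP[].
apply: le_Rintegral_ae => //; first exact: integrable_itv_cst.
by apply: ae_imply fc => x fc /fc; rewrite ler_norml => /andP[].
Qed.

(** Lebesgue differentiation, for the restriction of g to [0, T] extended by 0. *)
Lemma ae_is_derive_indefinite_integral (g z : R -> R) (T : R) :
  mu.-integrable `[0, T] (EFin \o g) ->
  (forall t : R, 0 <= t <= T -> z t = z 0 + \int[mu]_(s in `[0, t]) g s) ->
  {ae mu, forall t : R, 0 < t < T -> is_derive t 1 z (g t)}.
Proof.
move=> ig zE.
pose g0 := g \_ `[0, T].
have lg0 : locally_integrable setT g0 by exact: integrable_locally_restrict.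
have ig0 (y : R) : mu.-integrable [set` Interval (BLeft 0) (BRight y)] (EFin \o g0).
  rewrite /g0 -restrict_EFin; apply/integrable_restrict => //.
  by apply: integrableS ig => //; do ?[exact: measurableI|exact: subIsetr].
have := FTC1 ig0 lg0.
apply: ae_imply => t dFt /andP[t0 tT].
have [|dF] := dFt; first by rewrite lte_fin.
rewrite /g0 patchE mem_set/=; last by rewrite in_itv/= !ltW.
move=> F't.
have nzE : \forall s \near t, z s = z 0 + \int[mu]_(r in `[0, s]) g0 r.
  near=> s.
  have s0 : 0 < s by near: s; exact: lt_nbhsr.
  have sT : s < T by near: s; exact: lt_nbhsl.
  rewrite zE ?ltW//; congr (_ + _); apply: eq_Rintegral => r.
  rewrite inE/= in_itv/= => /andP[r0 rs].
  by rewrite /g0 patchE mem_set//= in_itv/= r0 (le_trans rs)// ltW.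
have dz : is_derive t 1 (fun s => z 0 + \int[mu]_(r in `[0, s]) g0 r) (g t).
  rewrite -[g t]add0r -F't derive1E.
  by apply: is_deriveD => //; exact/derivableP.
by apply: near_eq_is_derive dz; apply: filterS nzE => s ->.
Unshelve. all: by end_near. Qed.

End integral_comparison.

Lemma integrable_RZl (R : realType) (D : set (measurableTypeR R))
    (f : R -> R) (r : R) :
  measurable D -> (@lebesgue_measure R).-integrable D (EFin \o f) ->
  (@lebesgue_measure R).-integrable D (EFin \o (fun x => r * f x)).
Proof. by move=> mD intf; exact: (integrableZl mD r intf). Qed.

Lemma integrable_RD (R : realType) (D : set (measurableTypeR R))
    (f h : R -> R) :
  measurable D -> (@lebesgue_measure R).-integrable D (EFin \o f) ->
  (@lebesgue_measure R).-integrable D (EFin \o h) ->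
  (@lebesgue_measure R).-integrable D (EFin \o (fun x => f x + h x)).
Proof. by move=> mD intf inth; exact: (integrableD mD intf inth). Qed.

Lemma integrable_Rsum (R : realType) (D : set (measurableTypeR R))
    (m : nat) (F : 'I_m -> R -> R) :
  measurable D ->
  (forall j, (@lebesgue_measure R).-integrable D (EFin \o F j)) ->
  (@lebesgue_measure R).-integrable D (EFin \o (fun x => \sum_(j < m) F j x)).
Proof.
move=> mD iF.
have -> : EFin \o (fun x => \sum_(j < m) F j x) =
    (fun x => \sum_(j < m) (EFin \o F j) x)%E.
  by apply/funext => x /=; rewrite sumEFin.
by apply: integrable_sum.
Qed.

Lemma Rintegral_sum (R : realType) (D : set (measurableTypeR R))
    (m : nat) (F : 'I_m -> R -> R) :
  measurable D ->
  (forall j, (@lebesgue_measure R).-integrable D (EFin \o F j)) ->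
  \int[@lebesgue_measure R]_(x in D) (\sum_(j < m) F j x) =
  \sum_(j < m) \int[@lebesgue_measure R]_(x in D) F j x.
Proof.
move=> mD iF; apply: EFin_inj; rewrite -sumEFin.
rewrite /Rintegral fineK; last first.
  by apply: integrable_fin_num => //; exact: integrable_Rsum.
under eq_integral do rewrite -sumEFin.
rewrite integral_sum//; apply: eq_bigr => j _.
by rewrite fineK//; apply: integrable_fin_num => //; exact: iF.
Qed.

(** * Integrals of nonincreasing functions *)

Section nonincreasing.
Variable R : realType.
Notation mu := (@lebesgue_measure R).

Lemma integrable_itv_continuous_nonincreasing (E h : R -> R) (a b : R) :
  0 <= a -> continuous E ->
  (forall s t : R, 0 <= s -> s <= t -> h t <= h s) ->
  mu.-integrable `[a, b] (EFin \o (fun s => E s * h s)).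
Proof.
move=> a0 cE hni.
have mh : measurable_fun `[a, b] h.
  (* h is monotone on the half-line only; extend it by h 0 *)
  have : measurable_fun `[a, b] (fun s => h (Num.max s 0)).
    apply: nonincreasing_measurable => // s t st.
    apply: hni; first by rewrite le_max lexx orbT.
    by rewrite ge_max !le_max st lexx orbT.
  apply: eq_measurable_fun => s; rewrite inE/= in_itv/= => /andP[as_ _].
  by rewrite max_l// (le_trans a0).
apply: measurable_bounded_integrable => //.
- by rewrite /= lebesgue_measure_itv/=; case: ifPn => // _; rewrite -EFinD ltry.
- apply: measurable_funM => //.
  by apply: measurable_funTS; exact: continuous_measurable_fun.
- have [|ab] := ltP b a.
    move=> ba; rewrite set_itv_ge ?bnd_simp -?ltNge//.
    by exists 0; split=> // x _ y [].
  have : bounded_set (E @` `[a, b]).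
    apply: compact_bounded; apply: continuous_compact => //; last first.
      exact: segment_compact.
    exact: continuous_subspaceT.
  move=> [M [Mr ME]].
  exists ((`|M| + 1) * (`|h a| + `|h b|)); split; first exact: num_real.
  move=> x Mx s; rewrite /= in_itv/= => /andP[as_ sb].
  apply: le_trans (ltW Mx); rewrite normrM ler_pM//.
    by apply: ME; [rewrite ltr_pwDr// ler_norm|exists s; rewrite //= in_itv/= as_].
  have h1 := hni a s a0 as_.
  have h2 := hni s b (le_trans a0 as_) sb.
  have h3 := ler_norm (h a); have h4 := ler_norm (- h b).
  have h5 := normr_ge0 (h a); have h6 := normr_ge0 (h b).
  by rewrite normrN in h4; rewrite ler_norml; apply/andP; split; lra.
Qed.

Lemma integrable_itv_nonincreasing (h : R -> R) (a b : R) : 0 <= a ->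
  (forall s t : R, 0 <= s -> s <= t -> h t <= h s) ->
  mu.-integrable `[a, b] (EFin \o h).
Proof.
move=> a0 hni.
have := @integrable_itv_continuous_nonincreasing (cst 1) h a b a0
  (@cst_continuous _ _ _) hni.
by under [X in EFin \o X]eq_fun do rewrite /= mul1r.
Qed.

Variable h : R -> R.
Hypothesis h_ge0 : forall s : R, 0 <= s -> 0 <= h s.
Hypothesis h_noninc : forall s t : R, 0 <= s -> s <= t -> h t <= h s.

Lemma Rintegral_itv_le_half_line (t : R) :
  (\int[mu]_(s in `[0%R, +oo[) (h s)%:E < +oo)%E -> 0 <= t ->
  \int[mu]_(s in `[0, t]) h s <= fine (\int[mu]_(s in `[0%R, +oo[) (h s)%:E).
Proof.
move=> hfin t0.
have hge (s : R) : `[0%R, +oo[%classic s -> (0 <= (h s)%:E)%E.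
  by rewrite /= in_itv/= andbT lee_fin; exact: h_ge0.
have fin : (\int[mu]_(s in `[0%R, +oo[) (h s)%:E)%E \is a fin_num.
  by rewrite ge0_fin_numE// integral_ge0.
rewrite -lee_fin /Rintegral !fineK//; last first.
  by apply: integrable_fin_num => //; exact: integrable_itv_nonincreasing.
have -> : `[0, t]%classic = `[0, +oo[%classic `&` `[0, t]%classic :> set R.
  by rewrite setIidr//; apply: subset_itvl; rewrite bnd_simp.
rewrite integral_mkcondr; apply: le_lower_integral => s sD; rewrite patchE.
  by case: ifPn => // _; exact: hge.
by case: ifPn => // _; exact: hge.
Qed.

(** Monotone convergence along the intervals [0, m]. *)
Lemma Rintegral_itv_unbounded :
  (\int[mu]_(s in `[0%R, +oo[) (h s)%:E = +oo)%E ->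
  forall b : R, exists2 t : R, 0 <= t & b < \int[mu]_(s in `[0, t]) h s.
Proof.
move=> hoo b; apply: contrapT => nob.
have hb (t : R) : 0 <= t -> \int[mu]_(s in `[0, t]) h s <= b.
  by move=> t0; rewrite leNgt; apply/negP => ?; apply: nob; exists t.
have nnd : nondecreasing_seq (fun m : nat => `[0, 0 + m%:R]%classic : set R).
  move=> m p mp; apply/subsetPset; apply: subset_itvl.
  by rewrite bnd_simp !add0r ler_nat.
have cv : (\int[mu]_(s in `[0%R, (0 + m%:R)%R]) (h s)%:E)%E @[m --> \oo] -->
    (\int[mu]_(s in `[0%R, +oo[) (h s)%:E)%E.
  rewrite itv_bndy_bigcup_BRight; apply: ge0_nondecreasing_set_cvg_integral => //.
    by move=> m; apply: measurable_int (integrable_itv_nonincreasing _ _ h_noninc).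
  by move=> m s; rewrite /= in_itv/= lee_fin => /andP[/h_ge0].
have : (\int[mu]_(s in `[0%R, +oo[) (h s)%:E <= b%:E)%E.
  rewrite -(cvg_lim _ cv)//; apply: lime_le.
    by apply/cvg_ex; eexists; exact: cv.
  near=> m; have m0 : 0 <= 0 + m%:R :> R by rewrite addr_ge0.
  have := hb _ m0; rewrite -lee_fin /Rintegral fineK//.
  by apply: integrable_fin_num => //; exact: integrable_itv_nonincreasing.
by rewrite hoo leye_eq.
Unshelve. all: by end_near. Qed.

End nonincreasing.

(** * Leaky integrals *)

(** The solution of I' = h - k I with I(0) = 0, that is, the convolution of h
    with exp(-k t); the factored form makes it additive in the interval of
    integration. *)
Definition leaky_integral (R : realType) (k : R) (h : R -> R) (t : R) : R :=
  expR (- (k * t)) *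
    \int[@lebesgue_measure R]_(s in `[0, t]) (expR (k * s) * h s).

Section leaky_integral.
Variable R : realType.
Notation mu := (@lebesgue_measure R).

Lemma continuous_expRM (k : R) : continuous (fun s : R => expR (k * s)).
Proof.
move=> s; apply: continuous_comp; last exact: continuous_expR.
exact: mulrl_continuous.
Qed.

Lemma Rintegral_expRM (k s t : R) : 0 < k -> s <= t ->
  \int[mu]_(r in `[s, t]) expR (k * r) = (expR (k * t) - expR (k * s)) / k.
Proof.
move=> k0; rewrite le_eqVlt => /predU1P[<-|st].
  by rewrite set_itv1 Rintegral_set1 subrr mul0r.
have dF (r : R) : is_derive r 1 (fun r => expR (k * r) / k) (expR (k * r)).
  apply: is_derive_eq; rewrite /GRing.scale/=; field.
  by rewrite gt_eqF.
rewrite /Rintegral (@continuous_FTC2 _ _ (fun r => expR (k * r) / k))//.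
- by rewrite /= mulrBl.
- by apply: continuous_subspaceT; exact: continuous_expRM.
- have cF : continuous (fun r => expR (k * r) / k).
    by move=> r; apply/differentiable_continuous/derivable1_diffP.
  split => //; [exact/cvg_at_right_filter/cF|exact/cvg_at_left_filter/cF].
- by move=> r _; rewrite derive1E; exact: derive_val.
Qed.

Variables (k : R) (h : R -> R).
Hypothesis k_gt0 : 0 < k.
Hypothesis h_ge0 : forall s : R, 0 <= s -> 0 <= h s.
Hypothesis h_noninc : forall s t : R, 0 <= s -> s <= t -> h t <= h s.

Let ih a b (a0 : 0 <= a) : mu.-integrable `[a, b] (EFin \o h).
Proof. exact: integrable_itv_nonincreasing. Qed.

Let iEh a b (a0 : 0 <= a) :
  mu.-integrable `[a, b] (EFin \o (fun s => expR (k * s) * h s)).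
Proof.
by apply: integrable_itv_continuous_nonincreasing => //; exact: continuous_expRM.
Qed.

Let iE a b : mu.-integrable `[a, b] (EFin \o (fun s => expR (k * s))).
Proof.
apply: continuous_compact_integrable; first exact: segment_compact.
by apply: continuous_subspaceT; exact: continuous_expRM.
Qed.

Lemma leaky_integral_ge0 t : 0 <= leaky_integral k h t.
Proof.
rewrite mulr_ge0 ?expR_ge0//; apply: Rintegral_ge0 => s.
by rewrite /= in_itv/= => /andP[s0 _]; rewrite mulr_ge0 ?expR_ge0 ?h_ge0.
Qed.

Lemma leaky_integral_split s t : 0 <= s -> s <= t ->
  leaky_integral k h t = expR (- (k * (t - s))) * leaky_integral k h s
    + expR (- (k * t)) * \int[mu]_(r in `[s, t]) (expR (k * r) * h r).
Proof.
move=> s0 st; rewrite -(Rintegral_itv_diff s0 st (iEh _ _))//.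
rewrite /leaky_integral mulrA -expRD.
have -> : - (k * (t - s)) + - (k * s) = - (k * t) by ring.
by rewrite mulrBr addrC subrK.
Qed.

Lemma leaky_integral_le_add s t : 0 <= s -> s <= t ->
  leaky_integral k h t <= expR (- (k * (t - s))) * leaky_integral k h s
    + \int[mu]_(r in `[s, t]) h r.
Proof.
move=> s0 st; rewrite (leaky_integral_split s0 st) lerD2l.
rewrite -RintegralZl//; last exact: iEh.
apply: le_Rintegral => //.
- have -> : (fun r => expR (- (k * t)) * (expR (k * r) * h r)) =
            (fun r => expR (- (k * (t - r))) * h r).
    apply/funext => r; rewrite mulrA -expRD; congr (expR _ * _); ring.
  apply: integrable_itv_continuous_nonincreasing => // r.
  apply: continuous_comp; last exact: continuous_expR.
  have -> : (fun r => - (k * (t - r))) = (fun r => k * (r - t)).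
    by apply/funext => y; ring.
  by apply: cvgM; [exact: cvg_cst|apply: cvgB; [exact: cvg_id|exact: cvg_cst]].
- exact: ih.
move=> r /=; rewrite in_itv/= => /andP[sr rt].
rewrite mulrA -expRD; apply: ler_piMl; first by rewrite h_ge0// (le_trans s0).
by rewrite -expR0 ler_expR addrC -mulrBr mulr_ge0_le0 ?subr_le0// ltW.
Qed.

(** On [s, t] the weights have total mass at most 1 / k. *)
Lemma leaky_integral_le_cst s t : 0 <= s -> s <= t ->
  leaky_integral k h t <= expR (- (k * (t - s))) * leaky_integral k h s + h s / k.
Proof.
move=> s0 st; rewrite (leaky_integral_split s0 st) lerD2l.
have h0 := h_ge0 s0.
apply: (@le_trans _ _ (expR (- (k * t)) *
    \int[mu]_(r in `[s, t]) (expR (k * r) * h s))).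
  rewrite ler_wpM2l ?expR_ge0//; apply: le_Rintegral => //; first exact: iEh.
    apply: (@integrable_itv_continuous_nonincreasing _ _ (cst (h s))) => //.
    exact: continuous_expRM.
  move=> r /=; rewrite in_itv/= => /andP[sr rt].
  by rewrite ler_wpM2l ?expR_ge0// h_noninc.
rewrite RintegralZr// Rintegral_expRM//.
set D := expR (k * t) - _.
have -> : expR (- (k * t)) * (D / k * h s) = expR (- (k * t)) * D * (h s / k).
  by ring.
apply: ler_piMl; first by rewrite divr_ge0// ltW.
by rewrite /D mulrBr -!expRD addNr expR0 gerBl expR_ge0.
Qed.

(** The values of h on [0, t] are at least h t. This turns the product of the
    stepsize and the observation error into a leaky integral of the squared
    stepsize. *)
Lemma leaky_integral_self t : 0 <= t ->
  h t * leaky_integral k h t <= leaky_integral k (fun s => h s ^+ 2) t.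
Proof.
move=> t0; rewrite /leaky_integral mulrCA ler_wpM2l ?expR_ge0//.
rewrite -RintegralZl//; last exact: iEh.
apply: le_Rintegral => //.
- have -> : (fun s => h t * (expR (k * s) * h s)) =
            (fun s => (h t * expR (k * s)) * h s).
    by apply/funext => s; rewrite mulrA.
  apply: integrable_itv_continuous_nonincreasing => // s.
  by apply: cvgM; [exact: cvg_cst|exact: continuous_expRM].
- apply: integrable_itv_continuous_nonincreasing => //; first exact: continuous_expRM.
  move=> s r s0 sr; rewrite ler_pXn2r ?nnegrE ?h_noninc ?h_ge0//.
  exact: le_trans sr.
move=> s /=; rewrite in_itv/= => /andP[s0 st].
rewrite mulrCA ler_wpM2l ?expR_ge0// expr2 ler_wpM2r ?h_ge0//.
exact: h_noninc.
Qed.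

(** Once h is small it stays small, and the past is forgotten exponentially. *)
Lemma leaky_integral_cvg0 :
  (forall e : R, 0 < e -> exists2 s, 0 <= s & h s < e) ->
  leaky_integral k h t @[t --> +oo] --> (0 : R).
Proof.
move=> h_small; apply/cvgrPdist_le => e e0.
have e2 : 0 < e / 2 * k by rewrite mulr_gt0// divr_gt0.
have [s s0 hs] := h_small _ e2.
pose I := leaky_integral k h s.
have I0 : 0 <= I := leaky_integral_ge0 s.
near=> t.
have st : s <= t by near: t; apply: nbhs_pinfty_ge; rewrite num_real.
have tI : I / (e / 2) <= k * (t - s).
  rewrite mulrBr lerBrDr [k * t]mulrC -ler_pdivrMr//.
rewrite sub0r normrN ger0_norm ?leaky_integral_ge0//.
apply: le_trans (leaky_integral_le_cst s0 st) _.
rewrite (splitr e) lerD//; last by rewrite ler_pdivrMr// ltW.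
rewrite expRN mulrC ler_pdivrMr ?expR_gt0// mulrC -ler_pdivrMr ?divr_gt0//.
apply: le_trans tI _; apply: le_trans (expR_ge1Dx _).
by rewrite lerDr.
Unshelve. all: by end_near. Qed.

End leaky_integral.

(** * Quasi-Fejer monotone trajectories *)

(** The trajectory is bounded, since its distance to one minimiser is.  Along
    times where F (X t) tends to the minimum it has a cluster point p, which is
    a minimiser by continuity; the distance to p then becomes small at some
    time and cannot grow much afterwards. *)
Lemma quasi_fejer_cvg (R : realType) (d : nat) (F : 'rV[R]_d -> R)
    (X : R -> 'rV[R]_d) :
  continuous F -> argmin F !=set0 ->
  (forall z (e : R), argmin F z -> 0 < e -> exists T : R, forall s t : R,
     T <= s -> s <= t ->
     dot (X t - z) (X t - z) <= dot (X s - z) (X s - z) + e) ->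
  (forall z (e T : R), argmin F z -> 0 < e ->
     exists2 t : R, T <= t & F (X t) < F z + e) ->
  exists2 p, argmin F p & X t @[t --> +oo] --> p.
Proof.
move=> cF [z Fz] fejer minimizing.
have [T0 VT0] := fejer z 1 Fz ltr01.
have /choice[t tP] (m : nat) : exists t, [/\ T0 <= t, m%:R <= t &
    F (X t) < F z + m.+1%:R^-1].
  have [|t] := minimizing z m.+1%:R^-1 (Num.max T0 m%:R) Fz.
    by rewrite invr_gt0.
  by rewrite ge_max => /andP[? ?] ?; exists t.
pose M := `|z| + Num.sqrt (dot (X T0 - z) (X T0 - z) + 1).
have XM s : T0 <= s -> `|X s| <= M.
  move=> T0s; rewrite -(subrK z (X s)) addrC (le_trans (ler_normD _ _))// lerD2l.
  apply: le_trans (mx_norm_le_l2norm _) _.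
  by rewrite l2normE ler_wsqrtr// VT0.
pose K := [set v : 'rV[R]_d | `|v| <= M].
have cK : compact K.
  apply: bounded_closed_compact.
    exists M; split; first exact: num_real.
    by move=> r Mr v /= /le_trans; apply; exact: ltW.
  have -> : K = (fun v : 'rV[R]_d => `|v|) @^-1` [set r | r <= M] by [].
  apply: preimage_closed; last exact: closed_le.
  by move=> v _; exact: norm_continuous.
pose G := (fun m => X (t m)) @ \oo.
have [p [_ pG]] : K `&` cluster G !=set0.
  apply: cK; rewrite /G /=; near=> m.
  by apply: XM; have [] := tP m.
have Fpz : F p <= F z.
  apply/ler_addgt0Pr => e e0.
  have e2 : 0 < e / 2 by rewrite divr_gt0.
  have GA : \forall m \near \oo, F (X (t m)) <= F z + e / 2.
    near=> m; have [_ _ /ltW/le_trans] := tP m; apply.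
    by rewrite lerD2l ltW//; near: m; exact: (near_infty_natSinv_lt (PosNum e2)).
  have pB : nbhs p [set v | `|F p - F v| < e / 2].
    by have /cvgrPdist_lt := cF p; apply.
  have [v [/= Fv]] := pG [set v | F v <= F z + e / 2] _ GA pB.
  rewrite ltr_norml => /andP[_].
  by lra.
have Fp : argmin F p by move=> z'; exact: le_trans Fpz (Fz z').
exists p => //; apply/cvgrPdist_le => e e0.
have e2 : 0 < e ^+ 2 / 2 by rewrite divr_gt0// exprn_gt0.
have [T VT] := fejer p _ Fp e2.
(* the ball of radius del in the sup norm lies within Euclidean distance
   e / 2 of p *)
pose del := e / (2 * d.+1%:R).
have del0 : 0 < del by rewrite divr_gt0// mulr_gt0.
have GA : \forall m \near \oo, exists2 m', T <= t m' & X (t m) = X (t m').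
  near=> m; exists m => //; have [_ + _] := tP m; apply: le_trans.
  by near: m; exact: nbhs_infty_ger.
have pB : nbhs p [set v | `|p - v| < del].
  have /cvgrPdist_lt : v @[v --> p] --> p by exact: cvg_id.
  exact.
have [_ [[m Tm ->]]] :=
  pG [set v | exists2 m, T <= t m & v = X (t m)] _ GA pB.
rewrite /= distrC => pXm.
have Vm : dot (X (t m) - p) (X (t m) - p) <= e ^+ 2 / 2.
  have coord k : `|(X (t m) - p) 0 k| <= del.
    apply: le_trans (ltW pXm).
    rewrite [leRHS]/Num.Def.normr/= mx_normrE.
    exact: (le_bigmax _ (fun i => `|(X (t m) - p) i.1 i.2|) (0, k)).
  apply: le_trans (dot_le_coord (ltW del0) coord) _.
  have dn : d%:R <= d.+1%:R ^+ 2 :> R.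
    by rewrite -natrX ler_nat -mulnn (leq_trans (leqnSn d))// leq_pmulr.
  have N0 : d.+1%:R != 0 :> R by rewrite pnatr_eq0.
  have -> : e ^+ 2 / 2 = 2 * (d.+1%:R ^+ 2 * del ^+ 2) by rewrite /del; field.
  have := ler_wpM2r (sqr_ge0 del) dn.
  have : 0 <= d%:R * del ^+ 2 by rewrite mulr_ge0// sqr_ge0.
  lra.
near=> s.
rewrite distrC (le_trans (mx_norm_le_l2norm _))//.
rewrite l2normE -(ger0_norm (ltW e0)) -sqrtr_sqr ler_wsqrtr//.
have ts : t m <= s by near: s; apply: nbhs_pinfty_ge; rewrite num_real.
by have := VT _ _ Tm ts; lra.
Unshelve. all: by end_near. Qed.

(** * Perturbed gradient flow *)

Section perturbed_gradient_flow.
Variables (R : realType) (n d : nat) (f : 'I_n -> 'rV[R]_d -> R) (L : R).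
Notation mu := (@lebesgue_measure R).
Local Notation F := (fun z => \sum_(i < n) f i z).
Hypothesis f_convex : forall i, convex_function setT (f i).
Hypothesis f_diff : forall i z, differentiable (f i) z.
Hypothesis L_ge0 : 0 <= L.
Hypothesis f_lip : forall i z, l2norm (gradient (f i) z) <= L.

Variable alpha : R -> R.
Hypothesis alpha_range : forall t : R, 0 <= t -> 0 < alpha t <= 1.
Hypothesis alpha_noninc : forall s t : R,
  0 <= s -> s <= t -> alpha t <= alpha s.

Let alpha_ge0 t : 0 <= t -> 0 <= alpha t.
Proof. by move=> /alpha_range/andP[/ltW]. Qed.

Let alpha_le1 t : 0 <= t -> alpha t <= 1.
Proof. by move=> /alpha_range/andP[]. Qed.

Let alpha2_ge0 t : 0 <= t -> 0 <= alpha t ^+ 2.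
Proof. by rewrite sqr_ge0. Qed.

Let alpha2_noninc s t : 0 <= s -> s <= t -> alpha t ^+ 2 <= alpha s ^+ 2.
Proof.
move=> s0 st; rewrite ler_pXn2r ?nnegrE ?alpha_noninc ?alpha_ge0//.
exact: le_trans st.
Qed.

Let alpha2_le1 t : 0 <= t -> alpha t ^+ 2 <= 1.
Proof. by move=> t0; rewrite expr_le1// ?alpha_le1// alpha_ge0. Qed.

(** X stands for the average of the states and g for its velocity; P and K are
    the constants of the observer bound.  Nothing else is known about y. *)
Variables (X : R -> 'rV[R]_d) (g : 'I_d -> R -> R) (y : 'I_n -> R -> 'rV[R]_d).
Variables (c1 k P K : R).
Hypothesis c1_gt0 : 0 < c1.
Hypothesis k_gt0 : 0 < k.
Hypothesis P_ge0 : 0 <= P.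
Hypothesis K_ge0 : 0 <= K.
Hypothesis X_integral : forall (t : R) j, 0 <= t ->
  mu.-integrable `[0, t] (EFin \o g j) /\
  X t 0 j = X 0 0 j + \int[mu]_(s in `[0, t]) g j s.
Hypothesis g_feedback : forall T : R, {ae mu, forall t : R, 0 < t < T -> forall j,
  g j t = - (c1 * alpha t) * \sum_(i < n) gradient (f i) (y i t) 0 j}.

Let I := leaky_integral k alpha.
Let J := leaky_integral k (fun s => alpha s ^+ 2).
Let A2 t := \int[mu]_(s in `[0, t]) (alpha s ^+ 2).

Hypothesis y_near : forall i (t : R), 0 <= t ->
  l2norm (y i t - X t) <= P * expR (- (k * t)) + K * I t.

Let g_integrable j s t : 0 <= s -> s <= t -> mu.-integrable `[s, t] (EFin \o g j).
Proof.
move=> s0 st; have [+ _] := X_integral j (le_trans s0 st).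
exact: integrable_itvS.
Qed.

Let X_increment j s t : 0 <= s -> s <= t ->
  X t 0 j - X s 0 j = \int[mu]_(r in `[s, t]) g j r.
Proof.
move=> s0 st; have t0 := le_trans s0 st.
have [ig ->] := X_integral j t0; have [_ ->] := X_integral j s0.
by rewrite opprD addrACA subrr add0r; apply: Rintegral_itv_diff.
Qed.

Let g_feedback_itv s t : 0 < s -> {ae mu, forall r, `[s, t]%classic r -> forall j,
  g j r = - (c1 * alpha r) * \sum_(i < n) gradient (f i) (y i r) 0 j}.
Proof.
move=> s0; apply: ae_imply (g_feedback (t + 1)) => r gr.
rewrite /= in_itv/= => /andP[sr rt]; apply: gr.
by rewrite (lt_le_trans s0 sr)/= (le_lt_trans rt)// ltrDl.
Qed.

(** Since alpha <= 1, every coordinate of the velocity is at most c1 n L. *)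
Let M := Num.sqrt d%:R * (c1 * (n%:R * L)).

Let M_ge0 : 0 <= M.
Proof. by rewrite mulr_ge0 ?sqrtr_ge0// mulr_ge0 ?(ltW c1_gt0)// mulr_ge0. Qed.

Lemma flow_lipschitz s t : 0 < s -> s <= t -> l2norm (X t - X s) <= M * (t - s).
Proof.
move=> s0 st.
rewrite -(ger0_norm (mulr_ge0 M_ge0 _)) ?subr_ge0// -sqrtr_sqr l2normE ler_wsqrtr//.
rewrite /M -mulrA exprMn sqr_sqrtr//; apply: dot_le_coord.
  by rewrite mulr_ge0 ?subr_ge0// mulr_ge0 ?(ltW c1_gt0)// mulr_ge0.
move=> j; rewrite !mxE X_increment ?(ltW s0)//.
apply: abs_Rintegral_itv_le => //; first exact: g_integrable (ltW s0) st.
apply: ae_imply (g_feedback_itv t s0) => r gr /[dup] sr /gr ->.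
move: sr; rewrite /= in_itv/= => /andP[sr rt].
have r0 : 0 <= r by rewrite (le_trans (ltW s0)).
rewrite normrM normrN normrM (gtr0_norm c1_gt0) (ger0_norm (alpha_ge0 r0)).
rewrite -mulrA ler_pM2l//.
apply: (@le_trans _ _ (1 * (n%:R * L))); last by rewrite mul1r.
apply: ler_pM; rewrite ?alpha_ge0 ?alpha_le1//.
apply: le_trans (ler_norm_sum _ _ _) _.
rewrite mulr_natl -[in leRHS](card_ord n) -sumr_const.
apply: ler_sum => i _.
exact: le_trans (normr_coord_le_l2norm _ _) (f_lip _ _).
Qed.

(** Size, frozen at time s, of the stepsize times the observation error. *)
Let E s := P * expR (- (k * s)) + K * J s.

Let J_le s t : 0 <= s -> s <= t ->
  J t <= expR (- (k * (t - s))) * J s + (A2 t - A2 s).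
Proof.
move=> s0 st; rewrite /A2 Rintegral_itv_diff//.
  exact: leaky_integral_le_add.
by apply: integrable_itv_nonincreasing => //; exact: alpha2_noninc.
Qed.

Let J_ge0 t : 0 <= J t.
Proof. exact: leaky_integral_ge0. Qed.

Let A2_lip s t : 0 <= s -> s <= t -> 0 <= A2 t - A2 s <= t - s.
Proof.
move=> s0 st; rewrite /A2 Rintegral_itv_diff//; last first.
  by apply: integrable_itv_nonincreasing => //; exact: alpha2_noninc.
rewrite Rintegral_ge0/=; last by move=> r _; exact: sqr_ge0.
rewrite -[leRHS]mul1r -Rintegral_itv_cst//; apply: le_Rintegral => //.
- by apply: integrable_itv_nonincreasing => //; exact: alpha2_noninc.
- exact: integrable_itv_cst.
- move=> r; rewrite /= in_itv/= => /andP[sr _].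
  by rewrite alpha2_le1// (le_trans s0).
Qed.

Let alpha_y_near i s r : 0 <= s -> s <= r ->
  alpha r * l2norm (y i r - X r) <= E s + K * (r - s).
Proof.
move=> s0 sr; have r0 := le_trans s0 sr.
apply: le_trans (ler_wpM2l (alpha_ge0 r0) (y_near i r0)) _.
have h1 : alpha r * (P * expR (- (k * r))) <= P * expR (- (k * s)).
  apply: (@le_trans _ _ (1 * (P * expR (- (k * r))))).
    by rewrite ler_wpM2r ?alpha_le1// mulr_ge0 ?expR_ge0.
  by rewrite mul1r ler_wpM2l// ler_expR lerN2 ler_pM2l.
have h2 : alpha r * I r <= J r by apply: leaky_integral_self.
have h3 : J r <= J s + (r - s).
  apply: le_trans (J_le s0 sr) _; have /andP[_ ?] := A2_lip s0 sr.
  rewrite lerD// ler_piMl ?J_ge0//.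
  by rewrite -expR0 ler_expR oppr_le0 mulr_ge0 ?subr_ge0// ltW.
rewrite mulrDr (mulrCA _ K) /E.
have h4 := ler_wpM2l K_ge0 h2; have h5 := ler_wpM2l K_ge0 h3.
by rewrite mulrDr in h5; lra.
Qed.

Let a1 := 2 * c1 * (n%:R * (2 * L)).

Let a1_ge0 : 0 <= a1.
Proof. by rewrite !mulr_ge0// ltW. Qed.

Let gap z (s : R) := \sum_(i < n) f i (X s) - \sum_(i < n) f i z.

(** Write X t - z = (X s - z) + D.  The square of D is of second order.  The cross
    term is the integral over [s, t] of the inner product of X s - z with the
    velocity, to which convexity applies with the comparison point X s kept
    fixed; replacing times r in [s, t] by s in the errors costs another
    second-order term. *)
Lemma flow_descent z s t : 0 < s -> s <= t ->
  dot (X t - z) (X t - z) <= dot (X s - z) (X s - z)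
    - 2 * c1 * gap z s * \int[mu]_(r in `[s, t]) alpha r
    + a1 * (t - s) * E s + (a1 * (M + K) + M ^+ 2) * (t - s) ^+ 2.
Proof.
move=> s0 st; have s0' := ltW s0.
have ialpha : mu.-integrable `[s, t] (EFin \o alpha).
  exact: integrable_itv_nonincreasing.
pose D := X t - X s.
have -> : X t - z = (X s - z) + D by rewrite [RHS]addrC addrA subrK.
have -> : dot (X s - z + D) (X s - z + D) =
    dot (X s - z) (X s - z) + (2 * dot (X s - z) D + dot D D).
  by rewrite dotDl !(dotDr _ D) (dotC D (X s - z)); ring.
have DD : dot D D <= M ^+ 2 * (t - s) ^+ 2.
  rewrite -l2norm_sqr -exprMn ler_pXn2r ?nnegrE ?l2norm_ge0//.
    exact: flow_lipschitz.
  by apply: mulr_ge0; rewrite ?subr_ge0//; exact: M_ge0.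
pose B := c1 * (n%:R * (2 * L)) * (E s + (M + K) * (t - s)).
suff XD : dot (X s - z) D <=
    - (c1 * gap z s) * \int[mu]_(r in `[s, t]) alpha r + B * (t - s).
  have eB : a1 * (t - s) * E s + (a1 * (M + K) + M ^+ 2) * (t - s) ^+ 2 =
    2 * (B * (t - s)) + M ^+ 2 * (t - s) ^+ 2 by rewrite /B /a1; ring.
  rewrite -[leRHS]addrA eB; move: DD XD.
  rewrite mulNr -(mulrA 2 c1) -(mulrA 2); set q := c1 * gap z s * _; lra.
have ig j : mu.-integrable `[s, t] (EFin \o (fun r => (X s - z) 0 j * g j r)).
  by apply: integrable_RZl => //; exact: g_integrable.
have isum : mu.-integrable `[s, t]
    (EFin \o (fun r => \sum_(j < d) (X s - z) 0 j * g j r)).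
  exact: integrable_Rsum.
have -> : dot (X s - z) D =
    \int[mu]_(r in `[s, t]) (\sum_(j < d) (X s - z) 0 j * g j r).
  rewrite /dot; under eq_bigr => j _.
    rewrite [D 0 j]mxE [(- X s) 0 j]mxE X_increment// -RintegralZl//; last first.
      exact: g_integrable.
    over.
  by rewrite Rintegral_sum.
have iBa : mu.-integrable `[s, t]
    (EFin \o (fun r => - (c1 * gap z s) * alpha r)).
  exact: integrable_RZl.
have iB := @integrable_itv_cst R s t (B).
rewrite -RintegralZl// -(Rintegral_itv_cst B st) -RintegralD//.
apply: le_Rintegral_ae => //; first exact: integrable_RD.
apply: ae_imply (g_feedback_itv t s0) => r gr /[dup] sr /gr {}gr.
move: sr; rewrite /= in_itv/= => /andP[sr rt].
have r0 : 0 <= r by rewrite (le_trans s0').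
have -> : \sum_(j < d) (X s - z) 0 j * g j r =
    - (c1 * alpha r) * \sum_(i < n) dot (X s - z) (gradient (f i) (y i r)).
  rewrite exchange_big mulr_sumr; apply: eq_bigr => j _.
  by rewrite gr mulrCA; congr (_ * _); rewrite mulr_sumr.
have lower i : f i (X s) - f i z
      - 2 * L * (l2norm (X s - X r) + l2norm (X r - y i r))
    <= dot (X s - z) (gradient (f i) (y i r)).
  apply: le_trans
    (dot_gradient_lower_bound (f_diff i) (f_convex i) (f_lip i) _ _ _).
  rewrite lerD2l lerN2 ler_wpM2l ?mulr_ge0//.
  by apply: le_trans (ler_l2normD _ _); rewrite addrA subrK.
have lower' i : alpha r * (f i (X s) - f i z)
      - 2 * L * (E s + (M + K) * (t - s))
    <= alpha r * dot (X s - z) (gradient (f i) (y i r)).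
  apply: le_trans (ler_wpM2l (alpha_ge0 r0) (lower i)).
  rewrite [leRHS]mulrBr lerD2l lerN2 mulrCA ler_wpM2l ?mulr_ge0//.
  rewrite mulrDr.
  have h1 : alpha r * l2norm (X s - X r) <= M * (t - s).
    rewrite -opprB l2normN -[leRHS]mul1r ler_pM ?alpha_ge0 ?alpha_le1 ?l2norm_ge0//.
    by rewrite (le_trans (flow_lipschitz s0 sr))// ler_wpM2l// lerD2r.
  have h2 := alpha_y_near i s0' sr; rewrite -opprB l2normN in h2.
  have h3 : K * (r - s) <= K * (t - s) by rewrite ler_wpM2l// lerD2r.
  by lra.
have {lower'} := ler_sum (index_enum 'I_n) (fun i (_ : true) => lower' i).
rewrite sumrB sumr_const card_ord -[_ *+ n]mulr_natl -!mulr_sumr sumrB.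
rewrite -/(gap z s) => h.
have := ler_wpM2l (ltW c1_gt0) h; rewrite /B.
by set q := \sum_(i < n) _; lra.
Qed.

Variable B : R.
Hypothesis A2_le : forall t : R, 0 <= t -> A2 t <= B.

Let A t := \int[mu]_(s in `[0, t]) alpha s.

Let A_increment s t : 0 <= s -> s <= t ->
  A t - A s = \int[mu]_(r in `[s, t]) alpha r.
Proof.
move=> s0 st; apply: Rintegral_itv_diff => //.
exact: integrable_itv_nonincreasing.
Qed.

Let J_le_B t : 0 <= t -> J t <= B.
Proof.
move=> t0; apply: le_trans (A2_le t0).
have := J_le (lexx 0) t0.
rewrite /J /A2 /leaky_integral set_itv1 !Rintegral_set1.
by rewrite mulr0 mulr0 subr0 add0r.
Qed.

Let E_le s : 0 <= s -> E s <= P + K * B.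
Proof.
move=> s0; rewrite lerD//; last by rewrite ler_wpM2l// J_le_B.
by rewrite ler_piMr// -expR0 ler_expR oppr_le0 mulr_ge0// ltW.
Qed.

Let V z t := dot (X t - z) (X t - z).

(** Up to second order, exp(-kt) decreases at the rate k exp(-kt), and J minus
    the integral of alpha^2 at the rate k J.  With the factor a1 / k these
    decreases are a1 E, the error term in [flow_descent]. *)
Let W z t := V z t + a1 / k * (P * expR (- (k * t)) + K * (J t - A2 t)).

Let C := a1 * (M + K) + M ^+ 2 + a1 * k * (P + K * B).

Lemma lyapunov_increment z s t : 0 < s -> s <= t ->
  W z t - W z s <= C * (t - s) ^+ 2 - 2 * c1 * gap z s * (A t - A s).
Proof.
move=> s0 st; have s0' := ltW s0; pose tau := t - s.
have tau0 : 0 <= tau by rewrite subr_ge0.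
have := flow_descent z s0 st; rewrite -A_increment// -/tau => descent.
have kt0 : 0 <= k * tau by rewrite mulr_ge0// ltW.
have expk := expRN_le_quadratic kt0.
have hE : expR (- (k * t)) <= (1 - k * tau + (k * tau) ^+ 2) * expR (- (k * s)).
  have -> : - (k * t) = - (k * tau) + - (k * s) by rewrite /tau; ring.
  by rewrite expRD ler_wpM2r ?expR_ge0.
have hJ : J t - A2 t <= (1 - k * tau + (k * tau) ^+ 2) * J s - A2 s.
  have := J_le s0' st; rewrite -/tau => hJ.
  by have := ler_wpM2r (J_ge0 s) expk; lra.
have hP := ler_wpM2l P_ge0 hE.
have hK := ler_wpM2l K_ge0 hJ.
have hPK : a1 / k * (P * expR (- (k * t)) + K * (J t - A2 t))
    - a1 / k * (P * expR (- (k * s)) + K * (J s - A2 s))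
    <= - (a1 * tau * E s) + a1 * k * tau ^+ 2 * E s.
  have -> : - (a1 * tau * E s) + a1 * k * tau ^+ 2 * E s =
     a1 / k * ((- (k * tau) + (k * tau) ^+ 2) * E s).
    by field; rewrite gt_eqF.
  rewrite -mulrBr ler_wpM2l//; first by rewrite divr_ge0 ?a1_ge0 ?ltW.
  by rewrite /E; lra.
have hE2 : a1 * k * tau ^+ 2 * E s <= a1 * k * tau ^+ 2 * (P + K * B).
  by rewrite ler_wpM2l ?E_le// mulr_ge0 ?sqr_ge0// mulr_ge0 ?a1_ge0 ?ltW.
have -> : C * tau ^+ 2 = (a1 * (M + K) + M ^+ 2) * tau ^+ 2
   + a1 * k * tau ^+ 2 * (P + K * B) by rewrite /C; ring.
by rewrite /W /V; lra.
Qed.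

Lemma lyapunov_noninc z T (e : R) :
  0 < T -> (forall s, T <= s -> e <= gap z s) ->
  forall s t, T <= s -> s <= t ->
  W z t + 2 * c1 * e * A t <= W z s + 2 * c1 * e * A s.
Proof.
move=> T0 egap.
apply: (@le_of_sqr_increment _ (fun t => W z t + 2 * c1 * e * A t) _ C).
move=> s t Ts st; have s0 : 0 < s by exact: lt_le_trans Ts.
have := lyapunov_increment z s0 st.
have : 2 * c1 * e * (A t - A s) <= 2 * c1 * gap z s * (A t - A s).
  rewrite ler_wpM2r//; last by rewrite ler_pM2l ?egap// mulr_gt0.
  rewrite A_increment ?(ltW s0)//; apply: Rintegral_ge0 => r.
  rewrite /= in_itv/= => /andP[sr _].
  by apply: alpha_ge0; rewrite (le_trans (ltW s0)).
lra.
Qed.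

Let gap_ge0 z s : argmin F z -> 0 <= gap z s.
Proof. by move=> Fz; rewrite subr_ge0; exact: Fz. Qed.

Let alpha_small (e : R) : 0 < e -> exists2 s, 0 <= s & alpha s < e.
Proof.
move=> e0; apply: contrapT => noe.
have ea s : 0 <= s -> e <= alpha s.
  by move=> s0; rewrite leNgt; apply/negP => ?; apply: noe; exists s.
have e2 : 0 < e ^+ 2 by rewrite exprn_gt0.
(* by this time the integral of alpha^2 would exceed B *)
pose t := (`|B| + 1) / e ^+ 2.
have t0 : 0 <= t by rewrite divr_ge0 ?ltW// ltr_wpDl.
have := A2_le t0; apply/negP; rewrite -ltNge.
apply: (@lt_le_trans _ _ (e ^+ 2 * (t - 0))).
  by rewrite subr0 /t mulrC divfK ?gt_eqF// (le_lt_trans (ler_norm _))// ltrDl.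
rewrite -Rintegral_itv_cst//; apply: le_Rintegral => //.
- exact: integrable_itv_cst.
- by apply: integrable_itv_nonincreasing => //; exact: alpha2_noninc.
- move=> s; rewrite /= in_itv/= => /andP[s0 _].
  by rewrite ler_pXn2r ?nnegrE ?(ltW e0) ?alpha_ge0// ea.
Qed.

Let J_cvg0 : J t @[t --> +oo] --> (0 : R).
Proof.
apply: leaky_integral_cvg0 => // e e0.
have [s s0 se] := alpha_small e0; exists s => //.
apply: le_lt_trans se; rewrite expr2 ler_piMl ?alpha_ge0 ?alpha_le1//.
Qed.

Let expRN_cvg0 : expR (- (k * t)) @[t --> +oo] --> (0 : R).
Proof.
have -> : (fun t => expR (- (k * t))) =
  (fun z => expR (- z)) \o (fun t => k * t) by [].
apply: (@cvg_comp _ _ _ _ _ _ (pinfty_nbhs R)); last exact: cvgr_expR.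
exact: gt0_cvgMry.
Qed.

Let A2_tail (e : R) : 0 < e ->
  exists T, forall s t, T <= s -> s <= t -> A2 t - A2 s <= e.
Proof.
move=> e0.
pose S := [set A2 t | t in [set t | 0 <= t]].
have S0 : S !=set0 by exists (A2 0), 0 => /=.
have Sub : ubound S B by move=> _ [t /= t0 <-]; exact: A2_le.
have hS : has_sup S by split => //; exists B.
have [_ [T /= T0 <-] ST] := sup_adherent e0 hS.
exists T => s t Ts st.
have s0 : 0 <= s by exact: le_trans Ts.
have h1 : A2 t <= sup S.
  by apply: ub_le_sup; [exists B|exists t => //=; exact: le_trans st].
by have /andP[+ _] := A2_lip T0 Ts; lra.
Qed.

(** [lyapunov_noninc] at level 0; what W adds to the squared distance becomes
    negligible, with the tail of the integral of alpha^2. *)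
Lemma flow_fejer z (e : R) : argmin F z -> 0 < e -> exists T, forall s t,
  T <= s -> s <= t -> V z t <= V z s + e.
Proof.
move=> Fz e0.
have tail : \forall s \near +oo,
    a1 / k * (P * expR (- (k * s)) + K * J s) < e / 2.
  have cv : a1 / k * (P * expR (- (k * s)) + K * J s) @[s --> +oo] -->
      a1 / k * (P * 0 + K * 0).
    exact: (cvgM (cvg_cst _)
      (cvgD (cvgM (cvg_cst _) expRN_cvg0) (cvgM (cvg_cst _) J_cvg0))).
  rewrite !mulr0 addr0 mulr0 in cv.
  by apply: (cvgr_lt _ cv); rewrite divr_gt0.
have [T1 [_ T1P]] := tail.
pose q := a1 / k * K.
have q0 : 0 <= q by rewrite mulr_ge0// divr_ge0 ?a1_ge0 ?ltW.
have e4 : 0 < e / (2 * (q + 1)) by rewrite divr_gt0// mulr_gt0// ltr_wpDl.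
have [T2 T2P] := A2_tail e4.
exists (Num.max 1 (Num.max (T1 + 1) T2)) => s t.
rewrite !ge_max => /and3P[s1 T1s T2s] st.
have h1 := T1P s (lt_le_trans (ltr_pwDr ltr01 (lexx T1)) T1s).
have h2 := ler_wpM2l q0 (T2P s t T2s st).
have h3 : q * (e / (2 * (q + 1))) <= e / 2.
  have -> : q * (e / (2 * (q + 1))) = q / (q + 1) * (e / 2).
    by field; rewrite gt_eqF// ltr_wpDl.
  rewrite ler_piMl// ?divr_ge0 ?(ltW e0)//.
  by rewrite ler_pdivrMr ?mul1r ?lerDl// ltr_wpDl.
have := lyapunov_noninc ltr01 (fun s _ => gap_ge0 s Fz) s1 st.
have h4 : 0 <= a1 / k * (P * expR (- (k * t)) + K * J t).
  rewrite mulr_ge0 ?divr_ge0 ?a1_ge0 ?(ltW k_gt0)// addr_ge0//.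
    by rewrite mulr_ge0 ?expR_ge0.
  by rewrite mulr_ge0 ?J_ge0.
by rewrite mulr0 !mul0r !addr0 /W; rewrite /q in h2 h3; lra.
Qed.

Hypothesis A_unbounded : forall b : R, exists2 t : R, 0 <= t & b < A t.

(** A gap bounded below by e would, by [lyapunov_noninc], bound the integral of
    alpha, as W is bounded below. *)
Lemma flow_minimizing z (e T : R) : argmin F z -> 0 < e ->
  exists2 t, T <= t & F (X t) < F z + e.
Proof.
move=> Fz e0; apply: contrapT => nosmall.
pose T' := Num.max 1 T.
have T'1 : 1 <= T' by rewrite le_max lexx.
have T'0 : 0 < T' by exact: lt_le_trans T'1.
have egap s : T' <= s -> e <= gap z s.
  rewrite ge_max => /andP[_ Ts]; rewrite lerBrDl leNgt; apply/negP => small.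
  by apply: nosmall; exists s.
have noninc := lyapunov_noninc T'0 egap (lexx T').
pose w := a1 / k * (K * B).
have Wlow t : 0 <= t -> - w <= W z t.
  move=> t0; rewrite /W /w -subr_ge0 opprK -addrA -mulrDr.
  rewrite addr_ge0 ?dot_ge0// mulr_ge0 ?divr_ge0 ?a1_ge0 ?(ltW k_gt0)//.
  have := ler_wpM2l K_ge0 (A2_le t0).
  have := mulr_ge0 P_ge0 (expR_ge0 (- (k * t))).
  by have := mulr_ge0 K_ge0 (J_ge0 t); lra.
have ce : 0 < 2 * c1 * e by rewrite !mulr_gt0.
(* the first bound makes t late, the second contradicts noninc at time t *)
have [t t0 bt] := A_unbounded
  (Num.max (A T') ((W z T' + 2 * c1 * e * A T' + w) / (2 * c1 * e))).
move: bt; rewrite gt_max => /andP[AT' bt].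
have T't : T' <= t.
  rewrite leNgt; apply/negP => tT'.
  have : 0 <= A T' - A t.
    rewrite A_increment ?(ltW tT')//; apply: Rintegral_ge0 => r.
    rewrite /= in_itv/= => /andP[sr _].
    by apply: alpha_ge0; rewrite (le_trans t0).
  by rewrite subr_ge0 leNgt AT'.
move: bt; rewrite ltr_pdivrMr// mulrC; have := noninc t T't.
by have := Wlow t t0; lra.
Qed.

Let I_cvg0 : I t @[t --> +oo] --> (0 : R).
Proof. by apply: leaky_integral_cvg0 => // e /alpha_small. Qed.

Lemma perturbed_gradient_flow_cvg : argmin F !=set0 ->
  exists2 p, argmin F p & forall i, y i t @[t --> +oo] --> p.
Proof.
move=> Fne.
have cF : continuous F.
  apply: continuous_big => [x|i _ z]; first exact: add_continuous.
  exact: differentiable_continuous.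
have [p Fp Xp] := quasi_fejer_cvg cF Fne flow_fejer flow_minimizing.
exists p => // i.
have near0 : P * expR (- (k * t)) + K * I t @[t --> +oo] --> (0 : R).
  have cv : P * expR (- (k * t)) + K * I t @[t --> +oo] --> P * 0 + K * 0.
    exact: (cvgD (cvgM (cvg_cst _) expRN_cvg0) (cvgM (cvg_cst _) I_cvg0)).
  by rewrite !mulr0 addr0 in cv.
apply/cvgrPdist_lt => e e0.
have e2 : 0 < e / 2 by rewrite divr_gt0.
move/cvgrPdist_lt : Xp => /(_ _ e2) Xp.
near=> t.
have t0 : 0 <= t by near: t; apply: nbhs_pinfty_ge; rewrite num_real.
have h1 : `|p - X t| < e / 2 by near: t.
have h2 : P * expR (- (k * t)) + K * I t < e / 2.
  by near: t; exact: (cvgr_lt _ near0).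
have -> : p - y i t = (p - X t) - (y i t - X t) by rewrite opprB addrA subrK.
rewrite (le_lt_trans (ler_normB _ _))// (splitr e) ltrD//.
by apply: le_lt_trans h2; apply: le_trans (mx_norm_le_l2norm _) (y_near i t0).
Unshelve. all: by end_near. Qed.

End perturbed_gradient_flow.

(** * The closed loop *)

Lemma average_coord (R : realType) (n d : nat) (A : 'M[R]_(n, d)) (j : 'I_d) :
  average A 0 j = n%:R^-1 * \sum_(i < n) A i j.
Proof.
by rewrite /average !mxE summxE; congr (_ * _); apply: eq_bigr => i _; rewrite mxE.
Qed.

Definition average_velocity (R : realType) (n d : nat) (nw : 'I_n -> nat)
    (S : dynamics R d nw) (u x : R -> 'M[R]_(n, d))
    (w : R -> 'rV[R]_(\sum_(i < n) nw i)) (j : 'I_d) (t : R) : R :=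
  n%:R^-1 * \sum_(i < n) dyn_p S i t (x t) (w t) (row i (u t)) 0 j.

Section closed_loop.
Variables (R : realType) (n d : nat) (nw : 'I_n -> nat) (S : dynamics R d nw).
Variables (u x : R -> 'M[R]_(n, d)) (w : R -> 'rV[R]_(\sum_(i < n) nw i)).
Notation mu := (@lebesgue_measure R).
Local Notation g := (average_velocity S u x w).
Hypothesis xw_solution : solution S u x w.

Lemma average_integral (t : R) (j : 'I_d) : 0 <= t ->
  mu.-integrable `[0, t] (EFin \o g j) /\
  average (x t) 0 j = average (x 0) 0 j + \int[mu]_(s in `[0, t]) g j s.
Proof.
move=> t0.
have sol i := (xw_solution i).1 j t t0.
have ip i : mu.-integrable `[0, t]
    (EFin \o (fun s => dyn_p S i s (x s) (w s) (row i (u s)) 0 j)).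
  exact: (sol i).1.
have isum := integrable_Rsum (measurable_itv _) ip.
split; first exact: integrable_RZl.
rewrite RintegralZl// Rintegral_sum// !average_coord -mulrDr -big_split/=.
congr (_ * _); apply: eq_bigr => i _.
by have [_] := sol i; rewrite !mxE.
Qed.

(** Both sides are derivatives of the average almost everywhere: the left one by
    Lebesgue differentiation, the right one by the tracking property. *)
Lemma average_velocity_ae (c1 T : R) :
  {ae mu, forall t : R, 0 < t ->
     is_derive t 1 (fun s => average (x s)) (c1 *: \sum_(i < n) row i (u t))} ->
  {ae mu, forall t : R, 0 < t < T -> forall j,
     g j t = c1 * \sum_(i < n) u t i j}.
Proof.
move=> dX.
have dg (j : 'I_d) : {ae mu, forall t : R, 0 < t < T ->
    is_derive t 1 (fun s => average (x s) 0 j) (g j t)}.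
  have [T0|T0] := leP 0 T; last by apply: aeW => t /andP[t0 tT]; lra.
  apply: ae_is_derive_indefinite_integral; first by have [] := average_integral j T0.
  by move=> t /andP[t0 _]; have [] := average_integral j t0.
have {}dg : {ae mu, forall t : R, forall j, 0 < t < T ->
    is_derive t 1 (fun s => average (x s) 0 j) (g j t)}.
  exact: (filter_forall (ae_filter_ringOfSetsType mu) dg).
have := @filterI _ _ (ae_filter_ringOfSetsType mu) _ _ dX dg.
apply: ae_imply => t [dXt dgt] tT j.
have /andP[t0 _] := tT.
have [dA vA] := dXt t0.
have [_ <-] := dgt j tT.
have := derive_mx dA; rewrite vA => /matrixP/(_ 0 j).
rewrite !mxE => <-; congr (_ * _); rewrite summxE; apply: eq_bigr => i _.
by rewrite mxE.
Qed.

End closed_loop.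

(** The input need not be measurable, so the left-hand integral is only compared,
    not computed. *)
Lemma discounted_input_le (R : realType) (n d : nat) (u : R -> 'M[R]_(n, d))
    (alpha : R -> R) (L lambda k t : R) :
  (forall s : R, 0 <= s -> 0 <= alpha s) ->
  (forall s t : R, 0 <= s -> s <= t -> alpha t <= alpha s) ->
  0 <= L -> (forall i (s : R), 0 <= s -> l2norm (row i (u s)) <= alpha s * L) ->
  (forall r : R, 0 <= r -> lambda `^ r <= expR (- (k * r))) ->
  (\int[@lebesgue_measure R]_(s in `[0%R, t])
     (lambda `^ (t - s) * opnorm (u s))%:E <=
   (n%:R * L * leaky_integral k alpha t)%:E)%E.
Proof.
move=> a0 ani L0 uL lam.
pose c := n%:R * L * expR (- (k * t)).
have opu s : 0 <= s -> 0 <= opnorm (u s) <= n%:R * (alpha s * L).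
  by move=> s0; apply: opnorm_bounds => [|i]; [rewrite mulr_ge0 ?a0|exact: uL].
apply: (@le_trans _ _ (\int[@lebesgue_measure R]_(s in `[0%R, t])
    (c * (expR (k * s) * alpha s))%:E)%E).
  apply: le_lower_integral => s; rewrite /= in_itv/= => /andP[s0 st];
    rewrite lee_fin.
    by rewrite mulr_ge0 ?powR_ge0//; have /andP[] := opu s s0.
  have -> : c * (expR (k * s) * alpha s) =
      expR (- (k * (t - s))) * (n%:R * (alpha s * L)).
    have -> : - (k * (t - s)) = - (k * t) + k * s by ring.
    by rewrite expRD /c; ring.
  have /andP[u0 u1] := opu s s0.
  by rewrite ler_pM ?powR_ge0 ?lam ?subr_ge0.
have ie : (@lebesgue_measure R).-integrable `[0, t]
    (EFin \o (fun s => expR (k * s) * alpha s)).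
  by apply: integrable_itv_continuous_nonincreasing => //; exact: continuous_expRM.
rewrite -[leLHS]fineK; last first.
  by apply: integrable_fin_num => //; exact: integrable_RZl.
rewrite lee_fin -/(Rintegral _ _ _) RintegralZl// /leaky_integral.
by rewrite /c !mulrA.
Qed.

(** Enlarging lambda to at least 1/2 also covers lambda = 0, which has no
    logarithm. *)
Lemma powR_le_expR (R : realType) (lambda : R) : 0 <= lambda < 1 ->
  exists2 k : R, 0 < k & forall r : R, 0 <= r -> lambda `^ r <= expR (- (k * r)).
Proof.
move=> /andP[l0 l1]; pose m := Num.max lambda 2^-1.
have m0 : 0 < m by rewrite lt_max invr_gt0 ltr0n orbT.
have m1 : m < 1 by rewrite gt_max l1 invf_lt1// ltr1n.
exists (- ln m); first by rewrite oppr_gt0 ln_lt0// m0.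
move=> r r0; apply: le_trans (_ : m `^ r <= _).
  by apply: ge0_ler_powR; rewrite ?nnegrE// ?(ltW m0)// le_max lexx.
by rewrite /powR gt_eqF// mulNr opprK mulrC.
Qed.

Theorem theorem4p1 (R : realType) (n d : nat) (n_ge1 : (1 <= n)%N)
    (d_ge1 : (1 <= d)%N)
    (f : 'I_n -> 'rV[R]_d -> R)
    (f_convex : forall i, convex_function setT (f i))
    (f_diff : forall i z, differentiable (f i) z)
    (f_bounded_gradient :
       exists L : R, forall i z, l2norm (gradient (f i) z) <= L)
    (argmin_nonempty : argmin (fun z => \sum_(i < n) f i z) !=set0)
    (alpha : R -> R)
    (alpha_range : forall t, 0 <= t -> 0 < alpha t <= 1)
    (alpha_nonincreasing :
       forall s t, 0 <= s -> s <= t -> alpha t <= alpha s)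
    (alpha_integral :
       (\int[@lebesgue_measure R]_(t in `[0%R, +oo[) (alpha t)%:E = +oo)%E)
    (alpha2_integral :
       (\int[@lebesgue_measure R]_(t in `[0%R, +oo[) (alpha t ^+ 2)%:E < +oo)%E)
    (E : R -> rel 'I_n)
    (nw : 'I_n -> nat) (S : dynamics R d nw)
    (Q : set ('M[R]_(n, d) * 'rV[R]_(\sum_(i < n) nw i)))
    (S_continuous : continuous_solutions_exist S Q)
    (U : set (R -> 'M[R]_(n, d)))
    (U_smooth : @smooth_input R n d `<=` U)
    (S_tracker : distributed_flow_tracker S Q E U)
    (u x : R -> 'M[R]_(n, d)) (w : R -> 'rV[R]_(\sum_(i < n) nw i))
    (u_input : U u)
    (xw_solution : solution S u x w)
    (xw_initial : Q (x 0, w 0))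
    (u_feedback : forall i t, 0 <= t ->
       row i (u t) = - (alpha t *: gradient (f i) (output S u x w i t))) :
  exists2 xstar : 'rV[R]_d,
    argmin (fun z => \sum_(i < n) f i z) xstar &
    forall i, output S u x w i t @[t --> +oo] --> xstar.

Proof.
have [L f_lip] := f_bounded_gradient.
have [_ [c1 c1_gt0 avg_tracker] observer] := S_tracker.
have [lambda [c2 [lambda01 c2_gt0 y_bound]]] := observer u u_input.
have [k k_gt0 lambda_k] := powR_le_expR lambda01.
have L_ge0 : 0 <= L by apply: le_trans (f_lip (Ordinal n_ge1) 0); exact: l2norm_ge0.
have alpha_ge0 t : 0 <= t -> 0 <= alpha t by move=> /alpha_range/andP[/ltW].
have alpha2_noninc s t : 0 <= s -> s <= t -> alpha t ^+ 2 <= alpha s ^+ 2.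
  move=> s0 st; rewrite ler_pXn2r ?nnegrE ?alpha_nonincreasing ?alpha_ge0//.
  exact: le_trans st.
have op0 : 0 <= opnorm (x 0).
  have rows i : l2norm (row i (x 0)) <= \sum_(j < n) l2norm (row j (x 0)).
    by rewrite (bigD1 i)//= lerDl sumr_ge0// => j _; exact: l2norm_ge0.
  by have /andP[] := opnorm_bounds (sumr_ge0 _ (fun j _ => l2norm_ge0 _)) rows.
have u_le i s : 0 <= s -> l2norm (row i (u s)) <= alpha s * L.
  move=> s0; rewrite u_feedback// l2normN l2normZ ger0_norm ?alpha_ge0//.
  by rewrite ler_wpM2l ?alpha_ge0.
have y_near i t : 0 <= t -> l2norm (output S u x w i t - average (x t)) <=
    c2 * opnorm (x 0) * expR (- (k * t)) +
    c2 * (n%:R * L) * leaky_integral k alpha t.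
  move=> t0; rewrite -lee_fin.
  apply: le_trans (y_bound x w xw_initial xw_solution i t t0) _.
  have int_le := @discounted_input_le R n d u alpha L lambda k t
    alpha_ge0 alpha_nonincreasing L_ge0 u_le lambda_k.
  apply: (@le_trans _ _ (c2%:E * ((expR (- (k * t)) * opnorm (x 0))%:E
      + (n%:R * L * leaky_integral k alpha t)%:E))%E).
    rewrite lee_wpmul2l ?lee_fin ?(ltW c2_gt0)// leeD// lee_fin.
    by rewrite ler_wpM2r// lambda_k.
  by rewrite -EFinD -EFinM lee_fin le_eqVlt; apply/orP; left; apply/eqP; ring.
have feedback T : {ae @lebesgue_measure R, forall t : R, 0 < t < T -> forall j,
    average_velocity S u x w j t =
    - (c1 * alpha t) * \sum_(i < n) gradient (f i) (output S u x w i t) 0 j}.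
  have := average_velocity_ae xw_solution T
    (avg_tracker u x w u_input xw_initial xw_solution).
  apply: ae_imply => t gt tT j; rewrite gt// !mulr_sumr; apply: eq_bigr => i _.
  have /andP[/ltW t0 _] := tT.
  have /matrixP/(_ 0 j) := u_feedback i t t0; rewrite !mxE => ->; ring.
apply: (perturbed_gradient_flow_cvg f_convex f_diff L_ge0 f_lip alpha_range
  alpha_nonincreasing c1_gt0 k_gt0 _ _ (average_integral xw_solution) feedback y_near).
- by rewrite mulr_ge0// ltW.
- by rewrite mulr_ge0 ?(ltW c2_gt0)// mulr_ge0.
- move=> t t0.
  apply: (Rintegral_itv_le_half_line _ alpha2_noninc alpha2_integral t0) => s _.
  exact: sqr_ge0.
- exact: Rintegral_itv_unbounded.
- exact: argmin_nonempty.
Qed.
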